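(* Let $\Theta$ be the set of $f\in R_{\mathrm{hom}}$ such that there exists a line $\ell$ defined over $\mathbb{F}_q$ with $C_f$ singular at every $\mathbb{F}_q$-point of $\ell$. Then \[(q^2 + q + 1)q^{-3(q+1)}(1 - q^{-3q+2}) \leq \mu(\Theta) \leq (q^2+q+1)q^{-3(q+1)}.\]
   Context: Let $q$ be a prime power. For $d\ge1$ let $R_d\subseteq\mathbb{F}_q[x,y,z]$ be the space of homogeneous polynomials of degree $d$ (including $0$), $R_{\mathrm{hom}}=\bigcup_{d\ge1}R_d$, and $\mu(\mathcal{P})=\lim_{d\to\infty}|\mathcal{P}\cap R_d|/|R_d|$. $C_f=\{f=0\}\subseteq\mathbb{P}^2$ ($C_f=\mathbb{P}^2$ if $f=0$, in which case every point is considered singular). ''$C_f$ singular at $P$'' means $P\in C_f$ and $C_f$ is not smooth at $P$. *)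

(* Defs.v *)
From HB Require Import structures.
From mathcomp Require Import all_boot all_algebra all_field.
From mathcomp Require Import mpoly.
From Stdlib Require Import Reals.
Set Implicit Arguments. Unset Strict Implicit. Unset Printing Implicit Defensive.
Import GRing.Theory.

Section Defs.
Variable F : finFieldType.
Local Open Scope ring_scope.

Definition coeffs (d : nat) := {ffun 'X_{1..3 < d.+1} -> F}.

Definition poly_of (d : nat) (c : coeffs d) : {mpoly F[3]} :=
  \sum_(m : 'X_{1..3 < d.+1}) c m *: 'X_[bmnm m].

(* R_d : homogeneous polynomials of degree d (including 0), encoded by their
   coefficient vectors supported on monomials of degree exactly d. *)
Definition Rd (d : nat) : {set coeffs d} :=
  [set c : coeffs d | [forall m, (mdeg (bmnm m) != d) ==> (c m == 0)]].

(* C_f is singular at the projective point [v] (v a nonzero vector of F^3):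
   f(v) = 0 and all partial derivatives vanish at v. For f = 0 this holds at
   every point. *)
Definition singular_at (p : {mpoly F[3]}) (v : {ffun 'I_3 -> F}) : bool :=
  (p.@[v] == 0) && [forall i : 'I_3, (p^`M(i)).@[v] == 0].

Definition singular_along_line (p : {mpoly F[3]}) : bool :=
  [exists a : {ffun 'I_3 -> F}, (a != 0) &&
    [forall v : {ffun 'I_3 -> F},
       ((v != 0) && (\sum_(i < 3) a i * v i == 0)) ==> singular_at p v]].

Definition Theta_d (d : nat) : {set coeffs d} :=
  [set c in Rd d | singular_along_line (poly_of c)].

Definition theta_ratio (d : nat) : R :=
  (INR #|Theta_d d| / INR #|Rd d|)%R.

End Defs.

(* Main.v *)
Require Import Defs.
From HB Require Import structures.
From mathcomp Require Import all_boot all_algebra all_field.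
From mathcomp Require Import mpoly zify ring.
Set Implicit Arguments. Unset Strict Implicit. Unset Printing Implicit Defensive.
Import GRing.Theory.

(** By Euler's relation, being singular at an F-point amounts to the vanishing
    of a jet in F^3. Once d > 2 #|P^2(F)|, the map sending a form of degree d to
    its jets at all F-points is linear and onto, so its fibres have equal size
    and the density is the fraction of jet families that vanish along some
    line. A line has q + 1 points and two lines cover 2q + 1, hence the union
    bound gives the upper estimate and Bonferroni's inequality the lower one,
    using (q^2 + q) / 2 <= q^2. *)

(* Supplies the finZmodType structures on products and finite functions. *)
HB.saturate prod.
HB.saturate finfun_of.

(** * Counting: fibres of additive maps, union bounds, functions vanishing on a set *)

(** The fibres of [f] on the subgroup [G] are cosets of the kernel [K], hence equinumerous. [G] is a
    subset and not a type because [Rd] sits inside the larger group [coeffs d]. *)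
Lemma card_preim_additive (A B : finZmodType) (G : {set A}) (f : A -> B)
    (S : {set B}) :
  {in G &, forall x y, (x - y)%R \in G} ->
  {in G &, forall x y, f (x - y)%R = (f x - f y)%R} ->
  (forall b, exists2 x, x \in G & f x = b) ->
  #|[set x in G | f x \in S]| * #|B| = #|S| * #|G|.
Proof.
move=> GB fB fsurj; pose K := [set x in G | f x == 0%R].
have G0 : (0%R : A) \in G.
  by have [x Gx _] := fsurj 0%R; rewrite -(subrr x) GB.
have f0 : f 0%R = 0%R by rewrite -{1}(subrr (0 : A)%R) fB // subrr.
have GN x : x \in G -> (- x)%R \in G by rewrite -sub0r => /(GB _ _ G0).
have fN x : x \in G -> f (- x)%R = (- f x)%R.
  by move=> Gx; rewrite -(sub0r x) fB // f0 sub0r.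
have fib b : #|[set x in G | f x == b]| = #|K|.
  have [x Gx <-] := fsurj b.
  rewrite -(card_imset (mem K) (addrI x)); apply: eq_card => y.
  rewrite inE; apply/andP/imsetP => [[Gy /eqP fy]|[z]].
    exists (y - x)%R; last by rewrite addrC subrK.
    by rewrite !inE GB // fB // fy subrr eqxx.
  rewrite !inE => /andP[Gz /eqP fz] ->.
  have Gz' := GN _ Gz.
  by rewrite -[z]opprK GB // fB // fN // fz oppr0 subr0.
have main (T : {set B}) : #|[set x in G | f x \in T]| = #|T| * #|K|.
  rewrite -sum1_card (partition_big f (mem T)) /=; last first.
    by move=> x; rewrite inE => /andP[].
  transitivity (\sum_(b in T) #|K|); last by rewrite sum_nat_const.
  apply: eq_bigr => b Tb.
  rewrite -(fib b) -sum1_card; apply: eq_bigl => x; rewrite !inE.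
  by case: eqP => [->|]; rewrite ?Tb ?andbT ?andbF.
(* The same count with [T] the whole of [B]. *)
have -> : #|G| = #|B| * #|K|.
  rewrite -cardsT -main; apply: eq_card => x.
  by rewrite !inE andbT.
by rewrite main; lia.
Qed.

Lemma card_bigcup_leq_sum (T I : finType) (A : I -> {set T}) :
  #|\bigcup_i A i| <= \sum_i #|A i|.
Proof.
elim/big_rec2: _ => [|i y x _ le]; first by rewrite cards0.
exact: leq_trans (leq_card_setU _ _) (leq_add (leqnn _) le).
Qed.

(* If x lies in k >= 1 of the sets, then 2 + k^2 >= 3 k. *)
Lemma bonferroni2 (T I : finType) (A : I -> {set T}) :
  3 * \sum_i #|A i| <= 2 * #|\bigcup_i A i| + \sum_i \sum_j #|A i :&: A j|.
Proof.
pose k x := \sum_i (x \in A i : nat).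
have cardE_ (B : {set T}) : #|B| = \sum_x (x \in B : nat).
  by rewrite -sum1_card big_mkcond; apply: eq_bigr => x _; case: (x \in B).
have -> : \sum_i #|A i| = \sum_x k x.
  by rewrite exchange_big; apply: eq_bigr => i _; rewrite cardE_.
have -> : \sum_i \sum_j #|A i :&: A j| = \sum_x k x * k x.
  under [RHS]eq_bigr => x _ do rewrite /k big_distrlr /=.
  rewrite [RHS]exchange_big; apply: eq_bigr => i _.
  rewrite [RHS]exchange_big; apply: eq_bigr => j _.
  by rewrite cardE_; apply: eq_bigr => x _; rewrite inE mulnb.
rewrite cardE_ !big_distrr -big_split; apply: leq_sum => x _ /=.
case: bigcupP => [_|nx] /=; first by case: (k x) => [|[|n]] //; nia.
suff -> : k x = 0 by [].
apply: big1 => i _; apply/eqP; rewrite eqb0.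
by apply/negP => xi; case: nx; exists i.
Qed.

(** Vanishing on [S] means being supported in the complement of [S], with free values there. The
    product form avoids the exponent [#|I| - #|S|]. *)
Lemma card_ffun_vanishing (I : finType) (V : finZmodType) (S : {set I}) :
  #|[set j : {ffun I -> V} | [forall i in S, j i == 0%R]]| * #|V| ^ #|S|
  = #|V| ^ #|I|.
Proof.
have -> : #|[set j : {ffun I -> V} | [forall i in S, j i == 0%R]]|
  = #|pffun_on (0%R : V) (~: S) [set: V]|.
  apply: eq_card => j; rewrite inE; apply/forall_inP/pffun_onP.
    move=> j0; split=> [|x _]; last by rewrite inE.
    apply/subsetP => i; rewrite !inE => /=; apply: contraNN => Si.
    exact: j0.
  case=> /subsetP supp _ i Si; apply/negPn/negP => ji.
  by have := supp i ji; rewrite inE Si.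
rewrite card_pffun_on cardsT -expnD; congr (_ ^ _).
by have := cardsC S; lia.
Qed.

(** * Points and lines of the projective plane over a finite field *)

Section ProjectivePlane.
Variable F : finFieldType.
Local Open Scope ring_scope.
Local Notation V := {ffun 'I_3 -> F}.
Implicit Types a b v w : V.

(** The default [ord0] is reached only by the zero vector, which is therefore never normalized. *)
Definition pivot v : 'I_3 := odflt ord0 [pick i | v i != 0].

Definition normalized v := v (pivot v) == 1.

Lemma pivot_neq0 v : v != 0 -> v (pivot v) != 0.
Proof.
rewrite /pivot; case: pickP => [i vi _|v0] //= /eqP[].
by apply/ffunP => i; rewrite ffunE; apply/eqP/negPn/negP; rewrite v0.
Qed.

Lemma normalized_neq0 v : normalized v -> v != 0.
Proof. by apply: contraTneq => ->; rewrite /normalized ffunE eq_sym oner_eq0. Qed.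

Definition scalev (c : F) v : V := [ffun i => c * v i].

Lemma pivot_scalev c v : c != 0 -> pivot (scalev c v) = pivot v.
Proof.
move=> c0; rewrite /pivot; congr odflt; apply: eq_pick => i.
by rewrite ffunE mulf_eq0 negb_or c0.
Qed.

(** Every class of nonzero vectors up to scaling has exactly one normalized member, so this type is
    the projective plane. By duality it also parametrises the lines, through their coefficient
    vectors. *)
Definition pt := {v : V | normalized v}.

Implicit Types P l : pt.

Lemma normalized_normalize v : v != 0 -> normalized (scalev (v (pivot v))^-1 v).
Proof.
move=> v0; have p0 := pivot_neq0 v0.
by rewrite /normalized pivot_scalev ?invr_eq0 // ffunE mulVf.
Qed.

Lemma pt_scalev_eq P l c : val P = scalev c (val l) -> P = l.
Proof.
move=> eP; have P0 := normalized_neq0 (valP P).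
have c0 : c != 0.
  apply: contraNneq P0 => c0; rewrite eP c0; apply/eqP/ffunP => i.
  by rewrite !ffunE mul0r.
apply: val_inj; have := eqP (valP P).
rewrite {1 2}eP pivot_scalev // ffunE (eqP (valP l)) mulr1 => c1.
by rewrite eP c1; apply/ffunP => i; rewrite ffunE mul1r.
Qed.

Lemma pt_exists v : v != 0 -> exists P c, c != 0 /\ v = scalev c (val P).
Proof.
move=> v0; exists (Sub _ (normalized_normalize v0)), (v (pivot v)).
have p0 := pivot_neq0 v0; split=> //; apply/ffunP => i.
by rewrite SubK !ffunE mulVKf.
Qed.

(** A nonzero vector is uniquely a nonzero scalar times a normalized vector; the summand 1 is the
    zero vector. This turns counts of vectors in linear subspaces into counts of projective
    points. *)
Lemma card_cone (p : pred V) :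
  (forall c v, c != 0 -> p (scalev c v) = p v) -> p 0 ->
  (#|[set v | p v]| = 1 + (#|F| - 1) * #|[set P : pt | p (val P)]|)%N.
Proof.
move=> pZ p0.
have -> : [set v | p v] = (0 : V) |: [set v : V | (v != 0) && p v].
  by apply/setP => v; rewrite !inE; case: eqP => // ->.
rewrite cardsU1 inE eqxx /=; congr addn.
have <- : #|[set~ (0 : F)]| = (#|F| - 1)%N by rewrite cardsC1 subn1.
rewrite -cardsX -(card_in_imset (f := fun x : F * pt => scalev x.1 (val x.2))).
  apply: eq_card => v; rewrite inE; apply/andP/imsetP.
    move=> [v0 pv]; have [P [c [c0 ev]]] := pt_exists v0.
    by exists (c, P) => //; rewrite !inE c0 /= -(pZ c) // -ev.
  case=> -[c P]; rewrite !inE /= => /andP[c0 pP] ->; rewrite pZ //; split=> //.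
  apply/eqP => /ffunP /(_ (pivot (val P))); rewrite !ffunE (eqP (valP P)) mulr1.
  by apply/eqP.
move=> [c P] [e l]; rewrite !inE /= => /andP[c0 _] /andP[e0 _] eq_cP.
have ePl : P = l.
  apply: (@pt_scalev_eq _ _ (c^-1 * e)); apply/ffunP => i.
  have := congr1 (fun f : V => f i) eq_cP; rewrite !ffunE => ei.
  by rewrite -mulrA -ei mulKf.
rewrite -ePl in eq_cP *; congr pair.
have := congr1 (fun f : V => f (pivot (val P))) eq_cP.
by rewrite /= !ffunE (eqP (valP P)) !mulr1.
Qed.

Definition dotv a v : F := \sum_(i < 3) a i * v i.

Lemma dotvB a v w : dotv a (v - w) = dotv a v - dotv a w.
Proof.
by rewrite -sumrB; apply: eq_bigr => i _; rewrite !ffunE mulrBr.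
Qed.

Lemma dotvZ a c v : dotv a (scalev c v) = c * dotv a v.
Proof. by rewrite mulr_sumr; apply: eq_bigr => i _; rewrite ffunE mulrCA. Qed.

Lemma dotvZl a c v : dotv (scalev c a) v = c * dotv a v.
Proof. by rewrite mulr_sumr; apply: eq_bigr => i _; rewrite ffunE mulrA. Qed.

Lemma dotv0 a : dotv a 0 = 0.
Proof. by apply: big1 => i _; rewrite ffunE mulr0. Qed.

Lemma dotvC a v : dotv a v = dotv v a.
Proof. by apply: eq_bigr => i _; rewrite mulrC. Qed.

Definition basisv (i : 'I_3) : V := [ffun j => (i == j)%:R].

Lemma dotv_basisv a i : dotv a (basisv i) = a i.
Proof.
rewrite /dotv (bigD1 i) //= big1 => [|j ji]; rewrite ffunE.
  by rewrite eqxx mulr1 addr0.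
by rewrite eq_sym (negPf ji) mulr0.
Qed.

(** Distinct normalized vectors are not proportional, so some 2 by 2 minor involving the pivot
    column [i] of [P] is nonzero. The system is then solved by a vector supported on the columns [i]
    and [j]. *)
Lemma dotv_pair_surj P l : P != l ->
  forall st : F * F, exists v, (dotv (val P) v, dotv (val l) v) = st.
Proof.
move=> nPl [s t]; set a := val P; set b := val l; set i := pivot a.
have ai : a i = 1 by apply/eqP: (valP P).
have [j bj] : exists j, b j - b i * a j != 0.
  apply/existsP; apply: contraNT nPl; rewrite negb_exists => /forallP nj.
  rewrite eq_sym; apply/eqP/(@pt_scalev_eq _ _ (b i)); apply/ffunP => j.
  by have := nj j; rewrite negbK subr_eq0 ffunE => /eqP.
pose y := (t - b i * s) / (b j - b i * a j).
exists (scalev (s - y * a j) (basisv i) - scalev (- y) (basisv j)).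
rewrite !dotvB !dotvZ !dotv_basisv ai; congr pair; first by ring.
rewrite (_ : _ - _ = b i * s + y * (b j - b i * a j)); last by ring.
by rewrite divfK //; ring.
Qed.

Lemma dotv_surj P s : exists v, dotv (val P) v = s.
Proof.
exists (scalev s (basisv (pivot (val P)))).
by rewrite dotvZ dotv_basisv (eqP (valP P)) mulr1.
Qed.

Let cardF_gt1 : (1 < #|F|)%N := card_finRing_gt1 F.

Lemma card_vec : #|V| = (#|F| ^ 3)%N.
Proof. by rewrite card_ffun card_ord. Qed.

Lemma card_pt : #|{: pt}| = (#|F| ^ 2 + #|F| + 1)%N.
Proof.
have := @card_cone predT (fun _ _ _ => erefl) erefl.
have -> : #|[set v : V | predT v]| = (#|F| ^ 3)%N.
  by rewrite -card_vec; apply: eq_card => v; rewrite !inE.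
have -> : #|[set P : pt | predT (val P)]| = #|{: pt}|.
  by apply: eq_card => v; rewrite !inE.
by move: cardF_gt1; set q := #|F|; nia.
Qed.

Definition line (l : pt) : {set pt} := [set P : pt | dotv (val l) (val P) == 0].

(** The kernel of the nonzero functional has [q ^ 2] vectors, so [card_cone] gives
    [1 + (q - 1) * n = q ^ 2] for the number [n] of points. *)
Lemma card_line l : #|line l| = (#|F| + 1)%N.
Proof.
have := @card_cone (fun v => dotv (val l) v == 0).
rewrite dotv0 eqxx => /(_ _ isT) cone.
have := @card_preim_additive V F setT (dotv (val l)) [set 0].
rewrite cards1 cardsT card_vec.
have -> : [set v in [set: V] | dotv (val l) v \in [set 0]]
  = [set v | dotv (val l) v == 0] by apply/setP => v; rewrite !inE.
rewrite cone => [H|c v c0]; last by rewrite dotvZ mulf_eq0 (negPf c0).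
have : ((1 + (#|F| - 1) * #|line l|) * #|F| = 1 * #|F| ^ 3)%N.
  apply: H => [x y _ _|x y _ _|s]; first by rewrite inE.
    exact: dotvB.
  by have [v] := dotv_surj l s; exists v.
by move: cardF_gt1; set q := #|F|; nia.
Qed.

Lemma card_lineI l l' : l != l' -> #|line l :&: line l'| = 1%N.
Proof.
move=> nll'; pose f v := (dotv (val l) v, dotv (val l') v).
have := @card_cone (fun v => f v == 0); rewrite /f !dotv0 eqxx => cone.
have {cone} := cone _ isT.
have -> : [set P : pt | (dotv (val l) (val P), dotv (val l') (val P)) == 0]
  = line l :&: line l' by apply/setP => P; rewrite !inE.
move=> cone.
have := @card_preim_additive V (F * F)%type setT f [set 0].
rewrite cards1 cardsT card_vec card_prod.
have -> : [set v in [set: V] | f v \in [set 0]]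
  = [set v | f v == 0] by apply/setP => v; rewrite !inE.
rewrite cone => [H|c v c0]; last first.
  by rewrite !dotvZ /eq_op /= !mulf_eq0 (negPf c0).
have : ((1 + (#|F| - 1) * #|line l :&: line l'|) * (#|F| * #|F|)
   = 1 * #|F| ^ 3)%N.
  apply: H => [x y _ _|x y _ _|s]; first by rewrite inE.
    by rewrite /f !dotvB.
  by have [v] := dotv_pair_surj nll' s; exists v.
move: cardF_gt1; set q := #|F|; set x := #|_| => q1.
(* Cancelling [q * q] leaves [1 + (q - 1) * x = q]. *)
rewrite mul1n -[(q ^ 3)%N]/(q * (q * q))%N => /eqP.
by rewrite eqn_pmul2r ?muln_gt0 ?(ltnW q1) // => /eqP; nia.
Qed.

End ProjectivePlane.

(** * Homogeneous polynomials: Euler's relation and scaling *)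

Section Homogeneous.
Local Open Scope ring_scope.

(** By linearity it suffices to treat a monomial, which the operator ['X_i] times the [i]-th
    derivative multiplies by its exponent at [i]; these exponents sum to [d]. *)
Lemma euler_homog (n d : nat) (R : comNzRingType) (p : {mpoly R[n]}) :
  p \is d.-homog -> \sum_i 'X_i * p^`M(i) = d%:R *: p.
Proof.
move=> hp; rewrite [in RHS](mpolyE p) scaler_sumr.
under eq_bigr => i _ do rewrite {1}(mpolyE p) raddf_sum mulr_sumr /=.
rewrite exchange_big /=; apply: eq_big_seq => m /(dhomogP _ _ _ hp) /= dm.
rewrite scalerA mulrC -scalerA -dm mdegE natr_sum scaler_suml scaler_sumr.
apply: eq_bigr => i _; rewrite mderivZ mderivX -!scalerAr; congr (_ *: _).
(* With exponent 0 the truncated [m - U_(i)] is not the true quotient monomial, but its coefficient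
   is 0. *)
case mi: (m i) => [|k]; first by rewrite !scale0r.
congr (_ *: _); rewrite -mpolyXD addmC submK //.
by apply/mnm_lepP => j; rewrite mnmE; case: eqP => // <-; rewrite mi.
Qed.

Lemma meval_homogZ (n d : nat) (R : comNzRingType) (p : {mpoly R[n]})
    (v w : 'I_n -> R) (c : R) :
  p \is d.-homog -> (forall i, w i = c * v i) -> p.@[w] = c ^+ d * p.@[v].
Proof.
move=> hp wE; rewrite !mevalE mulr_sumr.
apply: eq_big_seq => m /(dhomogP _ _ _ hp) /= <-; rewrite mulrCA; congr (_ * _).
rewrite mdegE -prodrXr -big_split /=.
by apply: eq_bigr => i _; rewrite wE exprMn.
Qed.

Lemma dhomog_mderiv (n d : nat) (R : comNzRingType) (p : {mpoly R[n]}) i :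
  p \is d.-homog -> p^`M(i) \is d.-1.-homog.
Proof.
move=> hp; apply/dhomogP => m; rewrite mcoeff_msupp mcoeff_mderiv => pm.
have : (m + U_(i))%MM \in msupp p.
  by rewrite mcoeff_msupp; apply: contraNneq pm => ->; rewrite mul0rn.
by move/(dhomogP _ _ _ hp); rewrite /= mdegD mdeg1 addn1 => <-.
Qed.

Lemma dhomog_prod_const (n d : nat) (R : comNzRingType) (I : finType)
    (A : {set I}) (f : I -> {mpoly R[n]}) :
  (forall i, i \in A -> f i \is d.-homog) ->
  \prod_(i in A) f i \is (#|A| * d).-homog.
Proof.
move=> hf; rewrite -sum_nat_const.
elim/big_rec2: _ => [|i p e iA]; first exact: dhomog1.
by move=> /(dhomogM (hf i iA)).
Qed.

End Homogeneous.

(** * Jets of forms at the rational points, and their interpolation *)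

Section Jets.
Variable F : finFieldType.
Local Open Scope ring_scope.
Local Notation V := {ffun 'I_3 -> F}.
Local Notation pt := (pt F).

Lemma Rd_gt0 d : (0 < #|Rd F d|)%N.
Proof.
apply/card_gt0P; exists 0; rewrite inE; apply/forallP => m.
by rewrite ffunE eqxx implybT.
Qed.

Lemma poly_of_homog d (c : coeffs F d) : c \in Rd F d -> poly_of c \is d.-homog.
Proof.
rewrite inE => /forallP cd; apply: rpred_sum => m _.
have := cd m; case: eqP => /= [dm _|_ /eqP ->].
  by rewrite dhomogZ // dhomogX; apply/eqP.
by rewrite scale0r dhomog0.
Qed.

Lemma homog_poly_of d (p : {mpoly F[3]}) :
  p \is d.-homog -> exists2 c, c \in Rd F d & poly_of c = p.
Proof.
move=> hp; exists [ffun m : 'X_{1..3 < d.+1} => p@_m].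
  rewrite inE; apply/forallP => m; apply/implyP => dm.
  by rewrite ffunE (dhomog_nemf_coeff hp dm).
rewrite /poly_of [RHS](mpolywE (k := d.+1)).
  by apply: eq_bigr => m _; rewrite ffunE.
rewrite mmeasureE; apply/bigmax_leqP_seq => m /(dhomogP _ _ _ hp) /= dm _.
by rewrite dm.
Qed.

Lemma poly_ofB d (c e : coeffs F d) : poly_of (c - e) = poly_of c - poly_of e.
Proof.
by rewrite /poly_of -sumrB; apply: eq_bigr => m _; rewrite !ffunE scalerBl.
Qed.

(* By Euler's relation the omitted derivative, the one at the pivot of [v], is
   determined by the others and by the value. *)
Definition jet (v : V) (p : {mpoly F[3]}) : V :=
  [ffun i => if i == pivot v then p.@[v] else (p^`M(i)).@[v]].

Lemma jetB v p r : jet v (p - r) = jet v p - jet v r.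
Proof. by apply/ffunP => i; rewrite !ffunE mderivB !mevalB; case: ifP. Qed.

Lemma jetD v p r : jet v (p + r) = jet v p + jet v r.
Proof. by apply/ffunP => i; rewrite !ffunE mderivD !mevalD; case: ifP. Qed.

Lemma jet_sum v (I : finType) (f : I -> {mpoly F[3]}) :
  jet v (\sum_i f i) = \sum_i jet v (f i).
Proof.
apply: (big_morph _ (jetD v)).
by apply/ffunP => i; rewrite !ffunE mderiv0 !meval0 if_same.
Qed.

(** When the jet is zero, Euler's relation at [v] reduces to the pivot derivative times
    [v (pivot v) = 1], and its right side is a multiple of [p.@[v] = 0]. No division by [d] occurs,
    so the characteristic is arbitrary. *)
Lemma singular_at_jet d p (P : pt) :
  p \is d.-homog -> singular_at p (val P) = (jet (val P) p == 0).
Proof.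
move=> hp; set v := val P; apply/andP/eqP => [[/eqP p0 /forallP dp0]|j0].
  by apply/ffunP => i; rewrite !ffunE p0 (eqP (dp0 i)) if_same.
have jE i := congr1 (fun f : V => f i) j0.
have p0 : p.@[v] = 0 by have := jE (pivot v); rewrite !ffunE eqxx.
split; first by rewrite p0.
have dp0 i : i != pivot v -> (p^`M(i)).@[v] = 0.
  by move=> ni; have := jE i; rewrite !ffunE (negPf ni).
apply/forallP => i; have [->|/dp0 ->] := eqVneq i (pivot v); last exact: eqxx.
have := congr1 (meval v) (euler_homog hp).
rewrite mevalZ p0 mulr0 raddf_sum (bigD1 (pivot v)) //= big1.
  by rewrite addr0 mevalM mevalXU (eqP (valP P)) mul1r => ->.
by move=> j /dp0 pj; rewrite mevalM pj mulr0.
Qed.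

Lemma singular_at_scalev d p (v : V) c :
  p \is d.-homog -> singular_at p v -> singular_at p (scalev c v).
Proof.
move=> hp /andP[/eqP p0 /forallP dp0].
have wE i : scalev c v i = c * v i by rewrite ffunE.
rewrite /singular_at (meval_homogZ hp wE) p0 mulr0 eqxx /=.
apply/forallP => i.
by rewrite (meval_homogZ (dhomog_mderiv i hp) wE) (eqP (dp0 i)) mulr0.
Qed.

(** Singularity of a form and incidence with a line are both invariant under scaling, so the
    quantifiers over nonzero vectors may be restricted to normalized ones. *)
Lemma singular_along_lineE d p : p \is d.-homog ->
  singular_along_line p =
  [exists l : pt, [forall P in line l, jet (val P) p == 0]].
Proof.
move=> hp; apply/existsP/existsP => [[a /andP[a0 /forallP sa]]|[l /forall_inP sl]].
  have [l [c [c0 al]]] := pt_exists a0; exists l; apply/forall_inP => P.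
  rewrite inE => /eqP lP; rewrite -(singular_at_jet _ hp).
  apply: (implyP (sa (val P))); rewrite normalized_neq0 ?(valP P) //=.
  by rewrite -/(dotv a _) al dotvZl lP mulr0.
exists (val l); rewrite normalized_neq0 ?(valP l) //=.
apply/forallP => v; apply/implyP => /andP[v0 lv].
have [P [c [c0 vP]]] := pt_exists v0; rewrite vP.
apply: (singular_at_scalev _ hp); rewrite (singular_at_jet _ hp); apply: sl.
by rewrite inE; move: lv; rewrite -/(dotv _ v) vP dotvZ mulf_eq0 (negPf c0).
Qed.

Definition linform (a : V) : {mpoly F[3]} := \sum_(i < 3) a i *: 'X_i.

Lemma linform_homog a : linform a \is 1.-homog.
Proof. by apply: rpred_sum => i _; rewrite dhomogZ // dhomogX /= mdeg1. Qed.

Lemma meval_linform a (v : V) : (linform a).@[v] = dotv a v.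
Proof.
by rewrite raddf_sum; apply: eq_bigr => i _; rewrite /= mevalZ mevalXU.
Qed.

Lemma mderiv_linform a i : (linform a)^`M(i) = (a i)%:MP.
Proof.
rewrite raddf_sum (bigD1 i) //= big1 ?addr0 => [|j ji].
  rewrite mderivZ mderivX mnmE eqxx scale1r.
  rewrite (_ : (U_(i) - U_(i))%MM = 0%MM) ?mpolyX0 ?alg_mpolyC //.
  by apply/mnmP => j; rewrite !mnmE subnn.
by rewrite mderivZ mderivX mnmE (negPf ji) scale0r scaler0.
Qed.

Lemma separating_form (P Q : pt) : P != Q ->
  exists a : V, dotv a (val P) = 1 /\ dotv a (val Q) = 0.
Proof.
move=> nPQ; have [a] := dotv_pair_surj nPQ (1, 0).
by rewrite ![dotv _ a]dotvC => -[aP aQ]; exists a.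
Qed.

Lemma jet_mul_sqr (v : V) p r : r.@[v] = 0 -> jet v (p * r ^+ 2) = 0.
Proof.
move=> r0; apply/ffunP => i; rewrite !ffunE expr2 !mderivM !(mevalM, mevalD) r0.
by rewrite !(mulr0, mul0r, addr0) if_same.
Qed.

(* The product of squares of linear forms through the points other than P kills
   their jets and is a unit at P, where a further linear factor realises any
   jet. *)
Lemma local_jet d (P : pt) (w : V) : (2 * #|{: pt}| < d)%N ->
  exists p, [/\ p \is d.-homog, jet (val P) p = w &
    forall Q : pt, Q != P -> jet (val Q) p = 0].
Proof.
move=> dN; set v := val P; set k := pivot v.
have vk : v k = 1 by apply/eqP: (valP P).
have /fin_all_exists[a aP] : forall Q : pt, exists a : V,
  dotv a v = 1 /\ (Q != P -> dotv a (val Q) = 0).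
  (* For [Q = P] only the value 1 at [P] is asked; this form does not enter the product over [S]. *)
  move=> Q; have [->|nQ] := eqVneq Q P.
    by exists (basisv F k); rewrite dotvC dotv_basisv.
  by rewrite eq_sym in nQ; have [a [? ?]] := separating_form nQ; exists a.
(* The exponent [e] pads the degree of [G] up to [d - 1]; the bound on [d] keeps the subtraction
   from truncating. The padding variable ['X_k] equals 1 at [P]. *)
pose S := [set~ P]; pose e := (d - 1 - #|S| * 2)%N.
have SN : (#|S| < #|{: pt}|)%N.
  by rewrite cardsC1 prednK //; apply/card_gt0P; exists P.
pose G := (\prod_(Q in S) linform (a Q) ^+ 2) * 'X_k ^+ e.
have Gv : G.@[v] = 1.
  rewrite mevalM rmorphXn /= mevalXU vk expr1n mulr1 rmorph_prod big1 // => Q _.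
  by rewrite /= rmorphXn /= meval_linform (aP Q).1 expr1n.
have hG : G \is (d - 1).-homog.
  have -> : (d - 1 = #|S| * 2 + e)%N by rewrite /e; lia.
  apply: dhomogM.
    by apply: dhomog_prod_const => Q _; apply: dhomogMn 2%N (linform_homog _).
  have hX : ('X_k : {mpoly F[3]}) \is 1.-homog by rewrite dhomogX /= mdeg1.
  by have := dhomogMn e hX; rewrite mul1n.
have jetG (Q : pt) r : Q != P -> jet (val Q) (G * r) = 0.
  move=> nQ; rewrite /G (bigD1 Q) ?inE //=.
  have rot (x y z t : {mpoly F[3]}) : x * y * z * t = y * z * t * x by ring.
  rewrite rot; apply: jet_mul_sqr.
  by rewrite meval_linform (aP Q).2.
(* Since [G] is 1 at [v], the [i]-th derivative of [G * linform l] at [v] is that of [G] times the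
   value of [linform l], plus [l i]. Once that value is [w k], this forces [l i = b i] for [i != k];
   the coefficient at [k] is then chosen to make the value [w k], using [v k = 1]. *)
clearbody G; pose b i := w i - (G^`M(i)).@[v] * w k.
pose l : V := [ffun i => if i == k then w k - \sum_(j | j != k) b j * v j else b i].
have lv : (linform l).@[v] = w k.
  rewrite meval_linform /dotv (bigD1 k) //= ffunE eqxx vk mulr1.
  rewrite [X in _ + X](eq_bigr (fun j => b j * v j)) ?subrK // => j nj.
  by rewrite ffunE (negPf nj).
exists (G * linform l); split.
- have -> : d = (d - 1 + 1)%N by lia.
  exact: dhomogM hG (linform_homog l).
- apply/ffunP => i; rewrite ffunE mderivM mevalD !mevalM Gv lv !mul1r.
  have [->//|nk] := eqVneq i k.
  by rewrite mderiv_linform mevalC ffunE (negPf nk) addrC subrK.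
by move=> Q nQ; apply: jetG.
Qed.

Definition jets d (c : coeffs F d) : {ffun pt -> V} :=
  [ffun P : pt => jet (val P) (poly_of c)].

(** In the sum of the local forms of all points, only the form attached to [P] contributes to the
    jet at [P]. *)
Lemma jets_surj d (j : {ffun pt -> V}) : (2 * #|{: pt}| < d)%N ->
  exists2 c, c \in Rd F d & jets c = j.
Proof.
move=> dN.
have /fin_all_exists[p pP] P := local_jet P (j P) dN.
have [|c cd cp] := @homog_poly_of d (\sum_P p P).
  by apply: rpred_sum => P _; have [] := pP P.
exists c => //; apply/ffunP => P; rewrite ffunE cp jet_sum (bigD1 P) //= big1.
  by rewrite addr0; have [] := pP P.
by move=> Q nQ; have [_ _] := pP Q; apply; rewrite eq_sym.
Qed.

(** * Counting the jet families that vanish along some line *)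

Definition vanishing (l : pt) : {set {ffun pt -> V}} :=
  [set j : {ffun pt -> V} | [forall P in line l, j P == 0]].

(** An exact identity for every large [d]: the density sequence is eventually constant, and its
    limit is a proportion of jet families. *)
Lemma card_Theta_d d : (2 * #|{: pt}| < d)%N ->
  (#|Theta_d F d| * #|{ffun pt -> V}| = #|\bigcup_l vanishing l| * #|Rd F d|)%N.
Proof.
move=> dN.
have RdB : {in Rd F d &, forall x y, x - y \in Rd F d}.
  move=> x y; rewrite !inE => /forallP x0 /forallP y0.
  apply/forallP => m; apply/implyP => dm; rewrite !ffunE.
  by rewrite (eqP (implyP (x0 m) dm)) (eqP (implyP (y0 m) dm)) subrr.
rewrite -(card_preim_additive _ RdB (f := @jets d)); last 2 first.
- move=> x y _ _; apply/ffunP => P.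
  by rewrite !ffunE poly_ofB jetB.
- by move=> j; apply: jets_surj.
congr (_ * _)%N; apply: eq_card => c; rewrite inE [RHS]inE.
apply: andb_id2l => cd; rewrite (singular_along_lineE (poly_of_homog cd)).
apply/existsP/bigcupP => [[l /forall_inP lc]|[l _]].
  by exists l => //; rewrite inE; apply/forall_inP => P /lc; rewrite ffunE.
rewrite inE => /forall_inP lc; exists l; apply/forall_inP => P /lc.
by rewrite ffunE.
Qed.

Lemma card_jets : #|{ffun pt -> V}| = ((#|F| ^ 3) ^ #|{: pt}|)%N.
Proof. by rewrite card_ffun card_vec. Qed.

Lemma card_vanishing l :
  (#|vanishing l| * (#|F| ^ 3) ^ (#|F| + 1) = #|{ffun pt -> V}|)%N.
Proof. by rewrite -(card_line l) -card_vec card_ffun_vanishing [RHS]card_ffun. Qed.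

(** Vanishing along both lines is vanishing on their union, which has [2 * (q + 1) - 1] points as
    the lines share exactly one. *)
Lemma card_vanishingI l l' : l != l' ->
  (#|vanishing l :&: vanishing l'| * (#|F| ^ 3) ^ (2 * #|F| + 1)
   = #|{ffun pt -> V}|)%N.
Proof.
move=> nll'.
have -> : (2 * #|F| + 1 = #|line l :|: line l'|)%N.
  by have := cardsUI (line l) (line l'); rewrite !card_line card_lineI //; lia.
rewrite -card_vec [RHS]card_ffun -(card_ffun_vanishing _ (line l :|: line l')).
congr (_ * _)%N.
apply: eq_card => j; rewrite !inE.
apply/andP/forall_inP => [[/forall_inP jl /forall_inP jl'] P|jU].
  by rewrite inE => /orP[/jl|/jl'].
by split; apply/forall_inP => P Pl; apply: jU; rewrite inE Pl ?orbT.
Qed.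

Lemma card_bigcup_vanishing_le :
  (#|\bigcup_l vanishing l| * (#|F| ^ 3) ^ (#|F| + 1)
   <= (#|F| ^ 2 + #|F| + 1) * #|{ffun pt -> V}|)%N.
Proof.
apply: leq_trans (leq_mul (card_bigcup_leq_sum _) (leqnn _)) _.
rewrite big_distrl /= (eq_bigr _ (fun l _ => card_vanishing l)).
by rewrite sum_nat_const card_pt.
Qed.

(** Bonferroni's inequality multiplied by [Q ^ (2 * q + 1)], which clears all denominators. The
    double sum runs over ordered pairs: its diagonal reproduces the single sum [A], turning [3 * A]
    into [2 * A], and the remaining [N * (q ^ 2 + q)] pairs each contribute [T]. *)
Lemma card_bigcup_vanishing_ge :
  (2 * ((#|F| ^ 2 + #|F| + 1) * #|{ffun pt -> V}| * (#|F| ^ 3) ^ #|F|)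
   <= 2 * (#|\bigcup_l vanishing l| * (#|F| ^ 3) ^ (2 * #|F| + 1))
      + (#|F| ^ 2 + #|F| + 1) * (#|F| ^ 2 + #|F|) * #|{ffun pt -> V}|)%N.
Proof.
have := bonferroni2 vanishing.
set q := #|F|; set Q := (q ^ 3)%N; set T := #|{ffun pt -> V}|.
set U := #|_|; set N := (q ^ 2 + q + 1)%N; set A := (\sum_l _)%N => bonf.
have Q_exp : (Q ^ (2 * q + 1) = Q ^ (q + 1) * Q ^ q)%N.
  by rewrite -expnD; congr (_ ^ _)%N; lia.
have AE : (A * Q ^ (q + 1) = N * T)%N.
  rewrite big_distrl /= (eq_bigr _ (fun l _ => card_vanishing l)).
  by rewrite sum_nat_const card_pt.
have BE : ((\sum_l \sum_l' #|vanishing l :&: vanishing l'|) * Q ^ (2 * q + 1)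
    = N * T * Q ^ q + N * (q ^ 2 + q) * T)%N.
  have -> : (N * T * Q ^ q + N * (q ^ 2 + q) * T
      = \sum_(l : pt) (T * Q ^ q + (q ^ 2 + q) * T))%N.
    by rewrite sum_nat_const card_pt -/q -/N; ring.
  rewrite big_distrl; apply: eq_bigr => l _; rewrite (bigD1 l) //= mulnDl setIid.
  congr (_ + _)%N; first by rewrite Q_exp mulnA card_vanishing.
  rewrite big_distrl /=.
  have -> : (\sum_(l' | l' != l) #|vanishing l :&: vanishing l'| * Q ^ (2 * q + 1)
     = \sum_(l' in [set~ l]) T)%N.
    apply: eq_big => [l'|l' nl]; first by rewrite !inE.
    by rewrite card_vanishingI // eq_sym.
  by rewrite sum_nat_const cardsC1 card_pt addn1.
have := leq_mul bonf (leqnn (Q ^ (2 * q + 1))).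
rewrite mulnDl BE -!mulnA [(A * _)%N](_ : _ = N * T * Q ^ q)%N; last first.
  by rewrite Q_exp mulnA AE.
by lia.
Qed.

End Jets.

(* Passage to real ratios and the limit *)
From Stdlib Require Import Reals Lra.

(** Here [z] stands for [q ^ (3 * #|F| - 2)], in terms of which the powers in the counting bound
    become [z * q ^ 2] and [z * z * q ^ 7]. The slack [q ^ 2 - q] comes from replacing
    [(q ^ 2 + q) / 2] by [q ^ 2]. *)
Lemma ratio_ge (q z U T : R) : (2 <= q -> 0 < z -> 0 < T ->
  2 * ((q ^ 2 + q + 1) * T * (z * q ^ 2))
    <= 2 * (U * (z * z * q ^ 7)) + (q ^ 2 + q + 1) * (q ^ 2 + q) * T ->
  (q ^ 2 + q + 1) / (z * q ^ 5) * (1 - / z) <= U / T)%R.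
Proof.
move=> q2 z0 T0 H.
apply: (Rmult_le_reg_r (z * z * q ^ 7 * T)).
  have q7 : (0 < q ^ 7)%R by apply: pow_lt; lra.
  apply: Rmult_lt_0_compat => //; apply: Rmult_lt_0_compat => //.
  exact: Rmult_lt_0_compat.
rewrite (_ : (q ^ 2 + q + 1) / (z * q ^ 5) * (1 - / z) * (z * z * q ^ 7 * T)
  = (q ^ 2 + q + 1) * (z * q ^ 2 - q ^ 2) * T)%R; last by field; lra.
rewrite (_ : U / T * (z * z * q ^ 7 * T) = U * (z * z * q ^ 7))%R; last by field; lra.
suff : (0 <= (q ^ 2 + q + 1) * T * (q ^ 2 - q))%R by lra.
by apply: Rmult_le_pos; [apply: Rmult_le_pos|]; nra.
Qed.

Lemma ratio_le (N y U T : R) : (0 < y -> 0 < T -> U * y <= N * T ->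
  U / T <= N / y)%R.
Proof.
move=> y0 T0 H; apply: (Rmult_le_reg_r (y * T)); first exact: Rmult_lt_0_compat.
rewrite (_ : U / T * (y * T) = U * y)%R; last by field; lra.
by rewrite (_ : N / y * (y * T) = N * T)%R //; field; lra.
Qed.

Theorem mainTheorem8 (F : finFieldType) :
  let q := INR #|F| in
  exists mu : R,
    Un_cv (fun d => theta_ratio F d) mu /\
    ((q ^ 2 + q + 1) / q ^ (3 * (#|F| + 1)) * (1 - / q ^ (3 * #|F| - 2))
       <= mu)%R /\
    (mu <= (q ^ 2 + q + 1) / q ^ (3 * (#|F| + 1)))%R.
Proof.
move=> q; pose T := #|{ffun pt F -> {ffun 'I_3 -> F}}|.
pose U := #|\bigcup_(l : pt F) vanishing l|.
have n1 : (1 < #|F|)%N := card_finNzRing_gt1 F.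
have T0 : (0 < T)%N by rewrite /T card_jets !expn_gt0 (ltnW n1).
have INRD m n : INR (addn m n) = (INR m + INR n)%R := plus_INR m n.
have INRM m n : INR (muln m n) = (INR m * INR n)%R := mult_INR m n.
have INRX m n : INR (expn m n) = (INR m ^ n)%R.
  by elim: n => // n IH; rewrite expnS INRM IH.
have q1 : (2 <= q)%R by apply: (le_INR 2); apply/leP.
have T0' : (0 < INR T)%R by apply: (lt_INR 0); apply/ltP.
have powq k : (0 < q ^ k)%R by apply: pow_lt; lra.
exists (INR U / INR T)%R; split; last split.
- move=> eps eps0; exists (2 * #|{: pt F}|).+1 => d /leP dN.
  (* Beyond the threshold the ratio equals its limit, so the distance is 0 whatever [eps] is. *)
  suff -> : theta_ratio F d = (INR U / INR T)%R.
    by rewrite /Rdist Rminus_diag Rabs_R0.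
  have Rd0' : (0 < INR #|Rd F d|)%R by apply: (lt_INR 0); apply/ltP/Rd_gt0.
  have := congr1 INR (card_Theta_d dN); rewrite !INRM -/T -/U => E.
  rewrite /theta_ratio.
  apply: (Rmult_eq_reg_r (INR #|Rd F d| * INR T)%R); last by nra.
  by field_simplify; nra.
- have /leP/le_INR := card_bigcup_vanishing_ge F.
  rewrite !(INRD, INRM, INRX) -/T -/U -/q -!pow_mult => H.
  set z := (q ^ (3 * #|F| - 2))%R; have z0 : (0 < z)%R := powq _.
  (* The natural subtraction in the exponent of [z] is exact because [#|F|] exceeds 1. *)
  have xE : (q ^ (3 * #|F|)%coq_nat = z * q ^ 2)%R.
    by rewrite -pow_add; congr (q ^ _)%R; lia.
  have yE : (q ^ (3 * (#|F| + 1)) = z * q ^ 5)%R.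
    by rewrite -pow_add; congr (q ^ _)%R; lia.
  have wE : (q ^ (3 * (2 * #|F| + 1))%coq_nat = z * z * q ^ 7)%R.
    by rewrite -!pow_add; congr (q ^ _)%R; lia.
  by rewrite yE; apply: ratio_ge => //; rewrite -xE -wE; exact: H.
- have /leP/le_INR := card_bigcup_vanishing_le F.
  rewrite !(INRD, INRM, INRX) -/T -/U -/q -!pow_mult => H.
  exact: ratio_le.
Qed.
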